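(* Let $\mathbb{C}$ be a regular category admitting binary coproducts. Let $\mathbb{D}$ be a full subcategory of $\mathbb{C}$ which is a Mal'tsev category and which is closed under regular quotients and binary coproducts in $\mathbb{C}$. Then $\mathbb{D}$ is contained in $\mathsf{Mal}(\mathbb{C})$.
   Context: An internal relation from $X$ to $Y$ in a category $\mathbb{C}$ is a triple $(R,r_1,r_2)$ where $r_1:R\to X$ and $r_2:R\to Y$ are jointly monomorphic morphisms of $\mathbb{C}$. For an object $S$ and morphisms $f:S\to X$, $g:S\to Y$, write $fRg$ if there is $h:S\to R$ with $r_1h=f$ and $r_2h=g$. An object $S$ of $\mathbb{C}$ is a Mal'tsev object if for all objects $X,Y$, every internal relation $(R,r_1,r_2)$ from $X$ to $Y$ and all morphisms $x_1,x_2:S\to X$ and $y_1,y_2:S\to Y$: if $x_1Ry_2$, $x_2Ry_2$ and $x_2Ry_1$, then $x_1Ry_1$. A category is a Mal'tsev category if every object in it is a Mal'tsev object (no finite limits are required). $\mathsf{Mal}(\mathbb{C})$ denotes the full subcategory of $\mathbb{C}$ whose objects are the Mal'tsev objects of $\mathbb{C}$. A subcategory $\mathbb{D}$ of $\mathbb{C}$ is closed under regular quotients in $\mathbb{C}$ if the codomain of every regular epimorphism of $\mathbb{C}$ whose domain is in $\mathbb{D}$ is in $\mathbb{D}$. *)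

(* Defs.v *)
From Stdlib Require Import FinFun.

Set Implicit Arguments.
Unset Strict Implicit.
Unset Printing Implicit Defensive.

Declare Scope cat_scope.
Delimit Scope cat_scope with cat.
Local Open Scope cat_scope.

Record Category : Type := MkCategory {
  Obj :> Type;
  Hom : Obj -> Obj -> Type;
  idm : forall X, Hom X X;
  comp : forall X Y Z, Hom Y Z -> Hom X Y -> Hom X Z;
  comp_id_l : forall X Y (f : Hom X Y), comp (idm Y) f = f;
  comp_id_r : forall X Y (f : Hom X Y), comp f (idm X) = f;
  comp_assoc : forall W X Y Z (h : Hom Y Z) (g : Hom X Y) (f : Hom W X),
    comp h (comp g f) = comp (comp h g) f
}.
Arguments idm {c} X.
Arguments comp {c X Y Z} g f : rename.

Notation "g ∘ f" := (comp g f) (at level 40, left associativity) : cat_scope.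

Record Functor (J C : Category) : Type := MkFunctor {
  fobj :> J -> C;
  fmap : forall i j, Hom i j -> Hom (fobj i) (fobj j);
  fmap_id : forall i, fmap (idm i) = idm (fobj i);
  fmap_comp : forall i j k (b : Hom j k) (a : Hom i j),
    fmap (b ∘ a) = fmap b ∘ fmap a
}.

(* A full subcategory of C is given by its class of objects D : C -> Prop. *)
Definition full_subcategory (C : Category) (D : C -> Prop) : Category :=
  {| Obj := {X : C | D X};
     Hom := fun X Y => Hom (proj1_sig X) (proj1_sig Y);
     idm := fun X => idm (proj1_sig X);
     comp := fun X Y Z g f => g ∘ f;
     comp_id_l := fun X Y f => comp_id_l f;
     comp_id_r := fun X Y f => comp_id_r f;
     comp_assoc := fun W X Y Z h g f => comp_assoc h g f |}.

Definition contained_in (C : Category) (D E : C -> Prop) : Prop :=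
  forall X : C, D X -> E X.

(** * Limits and colimits *)

Definition is_cone (J C : Category) (F : Functor J C) (L : C)
    (p : forall j : J, Hom L (F j)) : Prop :=
  forall (i j : J) (a : Hom i j), fmap F a ∘ p i = p j.

Definition is_limit (J C : Category) (F : Functor J C) (L : C)
    (p : forall j : J, Hom L (F j)) : Prop :=
  is_cone p /\
  forall (T : C) (t : forall j : J, Hom T (F j)), is_cone t ->
    exists! u : Hom T L, forall j : J, p j ∘ u = t j.

Definition is_finite_category (J : Category) : Prop :=
  Finite J /\ forall i j : J, Finite (Hom i j).

Definition has_finite_limits (C : Category) : Prop :=
  forall (J : Category) (F : Functor J C), is_finite_category J ->
    exists (L : C) (p : forall j : J, Hom L (F j)), is_limit p.

Definition is_pullback (C : Category) (X Y Z P : C)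
    (f : Hom X Z) (g : Hom Y Z) (p : Hom P X) (q : Hom P Y) : Prop :=
  f ∘ p = g ∘ q /\
  forall (T : C) (a : Hom T X) (b : Hom T Y), f ∘ a = g ∘ b ->
    exists! u : Hom T P, p ∘ u = a /\ q ∘ u = b.

Definition is_kernel_pair (C : Category) (X Y K : C)
    (f : Hom X Y) (k1 k2 : Hom K X) : Prop :=
  is_pullback f f k1 k2.

Definition is_coequalizer (C : Category) (X Y Q : C)
    (f g : Hom X Y) (q : Hom Y Q) : Prop :=
  q ∘ f = q ∘ g /\
  forall (T : C) (t : Hom Y T), t ∘ f = t ∘ g -> exists! u : Hom Q T, u ∘ q = t.

Definition is_regular_epi (C : Category) (X Y : C) (e : Hom X Y) : Prop :=
  exists (W : C) (f g : Hom W X), is_coequalizer f g e.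

Definition is_coproduct (C : Category) (X Y S : C)
    (i : Hom X S) (j : Hom Y S) : Prop :=
  forall (T : C) (a : Hom X T) (b : Hom Y T),
    exists! u : Hom S T, u ∘ i = a /\ u ∘ j = b.

Definition has_binary_coproducts (C : Category) : Prop :=
  forall X Y : C, exists (S : C) (i : Hom X S) (j : Hom Y S), is_coproduct i j.

Definition is_regular_category (C : Category) : Prop :=
  has_finite_limits C /\
  (forall (X Y K : C) (f : Hom X Y) (k1 k2 : Hom K X), is_kernel_pair f k1 k2 ->
    exists (Q : C) (q : Hom X Q), is_coequalizer k1 k2 q) /\
  (forall (X Y Z P : C) (f : Hom X Z) (g : Hom Y Z) (p : Hom P X) (q : Hom P Y),
    is_pullback f g p q -> is_regular_epi f -> is_regular_epi q).

Definition closed_under_regular_quotients (C : Category) (D : C -> Prop) : Prop :=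
  forall (X Y : C) (e : Hom X Y), is_regular_epi e -> D X -> D Y.

(* Every coproduct in C of two objects of D lies in D: no coproducts are chosen. *)
Definition closed_under_binary_coproducts (C : Category) (D : C -> Prop) : Prop :=
  forall (X Y S : C) (i : Hom X S) (j : Hom Y S),
    is_coproduct i j -> D X -> D Y -> D S.

(** * Mal'tsev objects *)

Definition jointly_monic (C : Category) (R X Y : C)
    (r1 : Hom R X) (r2 : Hom R Y) : Prop :=
  forall (T : C) (u v : Hom T R), r1 ∘ u = r1 ∘ v -> r2 ∘ u = r2 ∘ v -> u = v.

Record Relation (C : Category) (X Y : C) : Type := MkRelation {
  rel_obj : C;
  rel_fst : Hom rel_obj X;
  rel_snd : Hom rel_obj Y;
  rel_jointly_monic : jointly_monic rel_fst rel_snd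
}.

Definition related (C : Category) (X Y : C) (R : Relation X Y) (S : C)
    (f : Hom S X) (g : Hom S Y) : Prop :=
  exists h : Hom S (rel_obj R), rel_fst R ∘ h = f /\ rel_snd R ∘ h = g.

Definition is_maltsev_object (C : Category) (S : C) : Prop :=
  forall (X Y : C) (R : Relation X Y) (x1 x2 : Hom S X) (y1 y2 : Hom S Y),
    related R x1 y2 -> related R x2 y2 -> related R x2 y1 -> related R x1 y1.

Definition is_maltsev_category (C : Category) : Prop :=
  forall S : C, is_maltsev_object S.

Definition Mal (C : Category) : C -> Prop := fun S => is_maltsev_object S.

(* Main.v *)
(** For [S] in [D], the conditions "[x1 R y2], [x2 R y2], [x2 R y1]" have a
    universal instance: the relation [Q] on [S + S] obtained as the image of the
    map [S + S + S -> (S + S) * (S + S)] whose components on the three summands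
    are [(i, j)], [(j, j)] and [(j, i)].  As a regular quotient of a coproduct of
    copies of [S], the object [Q] lies in [D], so the Mal'tsev property of [D]
    gives [i Q i].  For an arbitrary relation [R] in [C] satisfying the
    conditions, the induced map [S + S + S -> R] factors through the quotient
    [S + S + S -> Q] since [R] is jointly monic, and this carries [i Q i] to
    [x1 R y1]. *)

From Stdlib Require Import FinFun List Bool Eqdep_dec.
Require Import Defs.
Import ListNotations.

Set Implicit Arguments.
Unset Strict Implicit.
Unset Printing Implicit Defensive.

Local Open Scope cat_scope.

(** * Binary products and pullbacks from finite limits *)

Section Preorder.

Variables (T : Type) (le : T -> T -> bool).
Hypothesis le_refl : forall i, le i i = true.
Hypothesis le_trans :
  forall i j k, le j k = true -> le i j = true -> le i k = true.

Lemma bool_eq_irrelevance (a b : bool) (p q : a = b) : p = q.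
Proof. apply UIP_dec, bool_dec. Qed.

(** Taking boolean equations as morphisms makes any two parallel arrows provably equal and each
    hom-type decidably empty or a singleton, hence finite. *)
Definition preorder_category : Category :=
  {| Obj := T;
     Hom := fun i j => le i j = true;
     idm := le_refl;
     comp := le_trans;
     comp_id_l := fun _ _ _ => bool_eq_irrelevance _ _;
     comp_id_r := fun _ _ _ => bool_eq_irrelevance _ _;
     comp_assoc := fun _ _ _ _ _ _ _ => bool_eq_irrelevance _ _ |}.

Lemma preorder_category_finite : Finite T -> is_finite_category preorder_category.
Proof.
  intro HT; split; [exact HT|]; intros i j.
  destruct (bool_dec (le i j) true) as [p|np].
  - exists [p]; intro q; left; apply bool_eq_irrelevance.
  - exists []; intro q; contradiction.
Qed.

End Preorder.

Lemma eqb_trans (i j k : bool) :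
  eqb j k = true -> eqb i j = true -> eqb i k = true.
Proof. destruct i, j, k; auto. Qed.

(** The discrete category on two objects, whose limits are binary products. *)
Definition pair_category : Category := preorder_category eqb_reflx eqb_trans.

Definition pair_functor (C : Category) (X Y : C) : Functor pair_category C.
Proof.
  refine {| fobj := fun i : pair_category => if i : bool then X else Y;
            fmap := fun i j =>
              match i, j return
                eqb i j = true ->
                Hom (if i then X else Y : C) (if j then X else Y : C) with
              | true, true => fun _ => idm X
              | false, false => fun _ => idm Y
              | _, _ => fun a => False_rect _ (diff_false_true a)
              end |}.
  - intros []; reflexivity.
  - intros [] [] [] b a; try discriminate; symmetry; apply comp_id_l.
Defined.

Lemma binary_product_exists (C : Category) (X Y : C) :
  has_finite_limits C ->
  exists (P : C) (p : Hom P X) (q : Hom P Y),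
    jointly_monic p q /\
    forall (T : C) (a : Hom T X) (b : Hom T Y),
      exists u : Hom T P, p ∘ u = a /\ q ∘ u = b.
Proof.
  intro lim.
  destruct (lim pair_category (pair_functor X Y)) as [P [p [_ univ]]].
  { apply preorder_category_finite; exists [true; false]; intros []; simpl; auto. }
  assert (cone : forall (T : C) (a : Hom T X) (b : Hom T Y),
    is_cone (F := pair_functor X Y)
      (fun i => match i return Hom T (pair_functor X Y i) with
                | true => a | false => b end)).
  { intros T a b [] [] e; try discriminate; apply comp_id_l. }
  exists P, (p true), (p false); split.
  - intros T u v e1 e2.
    destruct (univ T _ (cone T (p true ∘ v) (p false ∘ v))) as [w [_ uniq]].
    rewrite <- (uniq u), <- (uniq v); auto; intros []; auto.
  - intros T a b; destruct (univ T _ (cone T a b)) as [u [eu _]].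
    exists u; exact (conj (eu true) (eu false)).
Qed.

(** The shape of a cospan: [None] is the common target, [Some true] and [Some false] are the two
    sources. *)
Definition cospan_le (i j : option bool) : bool :=
  match i, j with
  | _, None => true
  | Some a, Some b => eqb a b
  | None, Some _ => false
  end.

Lemma cospan_le_refl (i : option bool) : cospan_le i i = true.
Proof. destruct i as [[]|]; reflexivity. Qed.

Lemma cospan_le_trans (i j k : option bool) :
  cospan_le j k = true -> cospan_le i j = true -> cospan_le i k = true.
Proof. destruct i as [[]|], j as [[]|], k as [[]|]; simpl; auto. Qed.

Definition cospan_category : Category :=
  preorder_category cospan_le_refl cospan_le_trans.

Section Cospan.

Variables (C : Category) (X Y Z : C) (f : Hom X Z) (g : Hom Y Z).

Definition cospan_obj (i : option bool) : C :=
  match i with Some true => X | Some false => Y | None => Z end.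

Definition cospan_functor : Functor cospan_category C.
Proof.
  refine {| fobj := cospan_obj : cospan_category -> C;
            fmap := fun i j =>
              match i, j return
                cospan_le i j = true -> Hom (cospan_obj i) (cospan_obj j) with
              | Some true, Some true => fun _ => idm X
              | Some false, Some false => fun _ => idm Y
              | None, None => fun _ => idm Z
              | Some true, None => fun _ => f
              | Some false, None => fun _ => g
              | _, _ => fun a => False_rect _ (diff_false_true a)
              end |}.
  - intros [[]|]; reflexivity.
  - intros [[]|] [[]|] [[]|] b a; try discriminate; symmetry;
      first [apply comp_id_l | apply comp_id_r].
Defined.

Lemma pullback_exists :
  has_finite_limits C ->
  exists (P : C) (p : Hom P X) (q : Hom P Y), is_pullback f g p q.
Proof.
  intro lim.
  destruct (lim cospan_category cospan_functor) as [P [p [pcone univ]]].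
  { apply preorder_category_finite; exists [Some true; Some false; None].
    intros [[]|]; simpl; auto. }
  assert (el : f ∘ p (Some true) = p None).
  { exact (pcone (Some true) None eq_refl). }
  assert (er : g ∘ p (Some false) = p None).
  { exact (pcone (Some false) None eq_refl). }
  exists P, (p (Some true)), (p (Some false)); split.
  - rewrite el; auto.
  - intros T a b e.
    destruct (univ T (fun i => match i return Hom T (cospan_obj i) with
                               | Some true => a | Some false => b
                               | None => f ∘ a end)) as [u [eu uniq]].
    { intros [[]|] [[]|] h; try discriminate; simpl; auto using comp_id_l. }
    exists u; split.
    + exact (conj (eu (Some true)) (eu (Some false))).
    + intros v [e1 e2]; apply uniq; intros [[]|]; auto.
      (* At [None] the leg of the cone is forced, being [f] after the leg at [Some true]. *)
      rewrite <- el, <- comp_assoc, e1; reflexivity.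
Qed.

End Cospan.

(** * Image factorization *)

Lemma regular_epi_cancel (C : Category) (X Y Z : C) (e : Hom X Y)
    (u v : Hom Y Z) :
  is_regular_epi e -> u ∘ e = v ∘ e -> u = v.
Proof.
  intros [W [f [g [eq univ]]]] H.
  destruct (univ Z (v ∘ e)) as [w [_ uniq]].
  { rewrite <- !comp_assoc, eq; reflexivity. }
  rewrite <- (uniq u), <- (uniq v); auto.
Qed.

(** Take for [q] the coequalizer of the kernel pair of [f], and for [m] the map that [f] induces on
    it. *)
Lemma regular_epi_mono_factorization (C : Category) (A B : C) (f : Hom A B) :
  is_regular_category C ->
  exists (Q : C) (q : Hom A Q) (m : Hom Q B),
    is_regular_epi q /\ m ∘ q = f /\
    forall (T : C) (u v : Hom T Q), m ∘ u = m ∘ v -> u = v.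
Proof.
  intros [lim [coeq stable]].
  destruct (pullback_exists f f lim) as [K [k1 [k2 ker]]].
  destruct (coeq _ _ _ _ _ _ ker) as [Q [q Hq]].
  assert (req : is_regular_epi q) by (exists K, k1, k2; exact Hq).
  destruct ker as [ek kuniv], Hq as [eq quniv].
  destruct (quniv B f ek) as [m [em _]].
  exists Q, q, m; split; [exact req|split; [exact em|]].
  (* After a regular epimorphic change of base, [u] and [v] lift along [q] to a
     pair of maps equalized by [f], which [q] identifies. *)
  intros T u v e.
  destruct (pullback_exists q u lim) as [U [a [s pu]]].
  pose proof (stable _ _ _ _ _ _ _ _ pu req) as rs; destruct pu as [eu _].
  destruct (pullback_exists q (v ∘ s) lim) as [V [b [t pv]]].
  pose proof (stable _ _ _ _ _ _ _ _ pv req) as rt; destruct pv as [ev _].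
  apply (regular_epi_cancel rs), (regular_epi_cancel rt).
  destruct (kuniv V (a ∘ t) b) as [w [[w1 w2] _]].
  { rewrite <- em, <- (comp_assoc m q b), ev, !comp_assoc, <- e.
    rewrite <- (comp_assoc m q a), eu, !comp_assoc; reflexivity. }
  rewrite <- ev, <- eu, <- comp_assoc, <- w1, <- w2, !comp_assoc, eq.
  reflexivity.
Qed.

(** The relation is the image of the pairing of [a] and [b] into the product of [X] and [Y]. *)
Lemma regular_epi_relation_factorization (C : Category) (A X Y : C)
    (a : Hom A X) (b : Hom A Y) :
  is_regular_category C ->
  exists (R : Relation X Y) (q : Hom A (rel_obj R)),
    is_regular_epi q /\ rel_fst R ∘ q = a /\ rel_snd R ∘ q = b.
Proof.
  intro reg.
  destruct (binary_product_exists X Y (proj1 reg)) as [P [p1 [p2 [jm univ]]]].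
  destruct (univ A a b) as [f [fa fb]].
  destruct (regular_epi_mono_factorization f reg) as [Q [q [m [rq [em mono]]]]].
  assert (jm' : jointly_monic (p1 ∘ m) (p2 ∘ m)).
  { intros T u v e1 e2; apply mono, jm; rewrite !comp_assoc; assumption. }
  exists (MkRelation jm'), q; split; [exact rq|]; simpl.
  rewrite <- !comp_assoc, em; auto.
Qed.

(** * Relatedness along regular epimorphisms and coproducts *)

(** Joint monicity of [R] forces the witness on [A] to coequalize the pair whose coequalizer is [q],
    so it descends to [Q]. *)
Lemma regular_epi_relation_lift (C : Category) (A Q X Y : C) (R : Relation X Y)
    (q : Hom A Q) (c : Hom Q X) (d : Hom Q Y) :
  is_regular_epi q -> related R (c ∘ q) (d ∘ q) -> related R c d.
Proof.
  intros rq [h [h1 h2]].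
  pose proof rq as [W [f [g [eq univ]]]].
  destruct (univ _ h) as [k [ek _]].
  { apply (rel_jointly_monic (r := R)); rewrite !comp_assoc, ?h1, ?h2;
      rewrite <- !comp_assoc, eq; reflexivity. }
  exists k; split; apply (regular_epi_cancel rq); rewrite <- comp_assoc, ek;
    assumption.
Qed.

Lemma related_precomp (C : Category) (X Y S T : C) (R : Relation X Y)
    (f : Hom S X) (g : Hom S Y) (t : Hom T S) (f' : Hom T X) (g' : Hom T Y) :
  related R f g -> f ∘ t = f' -> g ∘ t = g' -> related R f' g'.
Proof.
  intros [h [h1 h2]] <- <-; exists (h ∘ t); rewrite !comp_assoc, h1, h2; auto.
Qed.

Lemma coproduct_hom_ext (C : Category) (X Y S T : C) (i : Hom X S) (j : Hom Y S)
    (u v : Hom S T) :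
  is_coproduct i j -> u ∘ i = v ∘ i -> u ∘ j = v ∘ j -> u = v.
Proof.
  intros cop ei ej; destruct (cop T (v ∘ i) (v ∘ j)) as [w [_ uniq]].
  rewrite <- (uniq u), <- (uniq v); auto.
Qed.

Lemma related_coproduct (C : Category) (A B S X Y : C) (i : Hom A S)
    (j : Hom B S) (R : Relation X Y) (f : Hom S X) (g : Hom S Y) :
  is_coproduct i j ->
  related R (f ∘ i) (g ∘ i) -> related R (f ∘ j) (g ∘ j) -> related R f g.
Proof.
  intros cop [h [h1 h2]] [k [k1 k2]].
  destruct (cop _ h k) as [u [[ui uj] _]].
  exists u; split; apply (coproduct_hom_ext cop);
    rewrite <- comp_assoc, ?ui, ?uj; assumption.
Qed.

Theorem corollary2p4 (C : Category) (D : C -> Prop) :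
  is_regular_category C ->
  has_binary_coproducts C ->
  is_maltsev_category (full_subcategory D) ->
  closed_under_regular_quotients D ->
  closed_under_binary_coproducts D ->
  contained_in D (@Mal C).
Proof.
  intros reg cop mal quot sums S DS X Y R x1 x2 y1 y2 r12 r22 r21.
  destruct (cop S S) as [S2 [i [j c2]]].
  destruct (cop S2 S) as [S3 [k [l c3]]].
  pose proof (sums _ _ _ _ _ c2 DS DS) as DS2.
  pose proof (sums _ _ _ _ _ c3 DS2 DS) as DS3.
  (* Since the copairing of [i] and [j] is the identity of [S2], the components of the map out of
     the triple sum are [a] = [id, j] and [b] = [d, i] with [d] = [j, j]. *)
  destruct (c2 _ j j) as [d [[di dj] _]].
  destruct (c3 _ (idm S2) j) as [a [[ak al] _]].
  destruct (c3 _ d i) as [b [[bk bl] _]].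
  destruct (regular_epi_relation_factorization a b reg) as [Q [q [rq [qa qb]]]].
  pose proof (quot _ _ _ rq DS3) as DQ.
  assert (relQ : related Q a b) by (exists q; auto).
  assert (Qii : related Q i i).
  (* [Q] is also a relation in the subcategory: joint monicity need only be tested there on objects
     of [D]. *)
  { set (D2 := exist D S2 DS2 : full_subcategory D).
    set (QD := @MkRelation (full_subcategory D) D2 D2 (exist D _ DQ)
      (rel_fst Q) (rel_snd Q) (fun T u v => @rel_jointly_monic _ _ _ Q _ u v)).
    (* The three premises are the restrictions of [relQ] to the three summands. *)
    apply (mal (exist D S DS) D2 D2 QD i j i j).
    - apply (related_precomp (t := k ∘ i) relQ);
        rewrite comp_assoc, ?ak, ?bk; [apply comp_id_l | exact di].
    - apply (related_precomp (t := k ∘ j) relQ);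
        rewrite comp_assoc, ?ak, ?bk; [apply comp_id_l | exact dj].
    - exact (related_precomp relQ al bl). }
  destruct (c2 _ x1 x2) as [x [[xi xj] _]].
  destruct (c2 _ y1 y2) as [y [[yi yj] _]].
  (* After precomposition with [q] this is checked on each summand of [S3], where it becomes [r12],
     [r22] and [r21]. *)
  assert (QR : related R (x ∘ rel_fst Q) (y ∘ rel_snd Q)).
  { apply (regular_epi_relation_lift rq).
    rewrite <- !comp_assoc, qa, qb.
    apply (related_coproduct c3);
      rewrite <- !comp_assoc, ?ak, ?bk, ?al, ?bl, ?comp_id_r;
      [apply (related_coproduct c2); rewrite <- ?comp_assoc, ?di, ?dj |];
      rewrite ?xi, ?xj, ?yi, ?yj; assumption. }
  destruct Qii as [h [h1 h2]].
  apply (related_precomp (t := h) QR); rewrite <- comp_assoc, ?h1, ?h2;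
    assumption.
Qed.
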